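(* Let $\Gamma=(V,E,\mathrm{wt})$ be a finite edge-weighted directed multigraph with vertices $v_1,\dots,v_n$, and let $\tilde\Gamma$ be a $k$-fold cover of $\Gamma$ (each lifted edge having the same weight as its base edge). Then for any vertex $v$ of $\Gamma$ with $A_v(\Gamma)\neq 0$ and any lift $\tilde v$ of $v$ in $\tilde\Gamma$, $$\frac{A_{\tilde v}(\tilde\Gamma)}{A_v(\Gamma)}=\frac1k\,\det\,[\mathscr L(\Gamma)]_{\mathbb Z[E]},$$ where $[\mathscr L(\Gamma)]_{\mathbb Z[E]}$ is the $n(k-1)\times n(k-1)$ matrix over $\mathbb Z[E]$ associated to the cover in the context.
   Context: Graphs are finite directed multigraphs (loops and multiple edges allowed). Each edge $e$ of $\Gamma$ carries a weight $\mathrm{wt}(e)$; the weights of the edges of $\Gamma$ are distinct indeterminates, and $\mathbb Z[E]$ denotes the polynomial ring over $\mathbb Z$ in them. For a vertex $w$, $E_s(w)$ (resp. $E_t(w)$) is the set of edges with source (resp. target) $w$; $e=(v,w)$ means $e$ has source $v$ and target $w$ (several edges may do so, and sums over $e=(v,w)$ range over all of them). Arborescences: an arborescence of a graph rooted at $v$ is a spanning tree directed towards $v$ (every vertex has a unique directed path to $v$ in the tree). Its weight is the product of the weights of its edges. $A_v(\cdot)$ is the sum of the weights of all arborescences rooted at $v$. Covers: a $k$-fold cover of $\Gamma$ is a graph $\tilde\Gamma=(\tilde V,\tilde E)$ with a map $\pi:\tilde\Gamma\to\Gamma$ sending vertices to vertices and edges to edges, compatible with sources and targets, such that $|\pi^{-1}(v)|=|\pi^{-1}(e)|=k$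 for all $v\in V,e\in E$, $\mathrm{wt}(\tilde e)=\mathrm{wt}(\pi(\tilde e))$ for all $\tilde e\in\tilde E$, and $\pi$ is a local homeomorphism, i.e. $\pi$ restricts to bijections $E_s(\tilde v)\to E_s(\pi(\tilde v))$ and $E_t(\tilde v)\to E_t(\pi(\tilde v))$ for every $\tilde v\in\tilde V$. $\tilde\Gamma$ need not be connected. A lift of $v$ is an element of $\pi^{-1}(v)$. The matrix: label the lifts of $v_i$ as $v_i^1,\dots,v_i^k$. Define $n(k-1)\times n(k-1)$ matrices $D$ (diagonal) and $A$, with rows and columns indexed by $v_1^2,\dots,v_n^2,v_1^3,\dots,v_n^3,\dots,v_1^k,\dots,v_n^k$, by $$D[v_i^t,v_i^t]=\sum_{e\in E_s(v_i^t)}\mathrm{wt}(e),\qquad A[v_i^t,v_j^r]=\sum_{e=(v_i^t,v_j^r)}\mathrm{wt}(e)-\sum_{e=(v_i^t,v_j^1)}\mathrm{wt}(e)\qquad(1<t,r\le k),$$ where edges are those of $\tilde\Gamma$, and set $[\mathscr L(\Gamma)]_{\mathbb Z[E]}:=D-A$. *)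

(* Defs.v *)
From HB Require Import structures.
From mathcomp Require Import all_boot all_order all_algebra.
From mathcomp Require Import fraction mpoly.
From mathcomp Require Import boolp.

Set Implicit Arguments.
Unset Strict Implicit.
Unset Printing Implicit Defensive.

Import GRing.Theory.
Local Open Scope ring_scope.

(* Finite edge-weighted directed multigraphs, loops allowed. *)
Record wdigraph (R : Type) := WDigraph {
  vertex : finType;
  edge : finType;
  src : edge -> vertex;
  tgt : edge -> vertex;
  wt : edge -> R }.

Arguments src {R w} e.
Arguments tgt {R w} e.
Arguments wt {R w} e.

Definition edges_from (R : Type) (G : wdigraph R) (w : vertex G)
  : {set edge G} := [set e | src e == w].

Definition edges_to (R : Type) (G : wdigraph R) (w : vertex G)
  : {set edge G} := [set e | tgt e == w].

Definition edges_between (R : Type) (G : wdigraph R) (v w : vertex G)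
  : {set edge G} := [set e | (src e == v) && (tgt e == w)].

(* The weights are distinct indeterminates, and there are no other
   indeterminates, so that {mpoly int[m]} is Z[E]. *)
Definition indeterminate_weights (m : nat) (G : wdigraph {mpoly int[m]})
  : Prop :=
  exists2 x : edge G -> 'I_m, bijective x & forall e : edge G, wt e = 'X_(x e).

Section Arborescences.
Variables (R : comNzRingType) (G : wdigraph R).
Implicit Types (T : {set edge G}) (x y v : vertex G).

Definition uadj T : rel (vertex G) :=
  [rel x y | [exists e in T, (e \in edges_between x y)
                          || (e \in edges_between y x)]].

(* (e, true) is e traversed from source to target, (e, false) is e traversed
   backwards. *)
Definition dart_start (d : edge G * bool) : vertex G :=
  if d.2 then src d.1 else tgt d.1.
Definition dart_end (d : edge G * bool) : vertex G :=
  if d.2 then tgt d.1 else src d.1.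

(* Cycles of the underlying undirected multigraph: a loop is a cycle of length
   1 and two edges with the same endpoints form a cycle of length 2. *)
Definition ucycle_in T (c : seq (edge G * bool)) : bool :=
  [&& c != [::],
      all (fun d => d.1 \in T) c,
      cycle (fun d d' => dart_end d == dart_start d') c,
      uniq [seq dart_start d | d <- c]
    & uniq [seq d.1 | d <- c]].

Definition spanning_tree T : Prop :=
  (forall x y, connect (uadj T) x y) /\ (forall c, ~~ ucycle_in T c).

Fixpoint diwalk T x (p : seq (edge G)) y : bool :=
  if p is e :: q then [&& e \in T, src e == x & diwalk T (tgt e) q y]
  else x == y.

Definition dipath T x (p : seq (edge G)) y : bool :=
  diwalk T x p y && uniq (x :: [seq tgt e | e <- p]).

Definition arborescence T v : Prop :=
  spanning_tree T /\ (forall x, exists! p : seq (edge G), dipath T x p v).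

Definition arb_sum v : R :=
  \sum_(T : {set edge G} | `[< arborescence T v >]) \prod_(e in T) wt e.

End Arborescences.

Record is_cover (R : Type) (k : nat) (G' G : wdigraph R)
  (pv : vertex G' -> vertex G) (pe : edge G' -> edge G) : Prop := IsCover {
  cover_src : forall e, src (pe e) = pv (src e);
  cover_tgt : forall e, tgt (pe e) = pv (tgt e);
  cover_card_vertex : forall v, #|pv @^-1: [set v]| = k;
  cover_card_edge : forall e, #|pe @^-1: [set e]| = k;
  cover_wt : forall e, wt e = wt (pe e);
  cover_from : forall w, {in edges_from w &, injective pe}
                         /\ pe @: edges_from w = edges_from (pv w);
  cover_to : forall w, {in edges_to w &, injective pe}
                       /\ pe @: edges_to w = edges_to (pv w) }.

(* lab i 1, ..., lab i k are the lifts of v i, without repetition; the values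
   lab i t for other t are irrelevant. *)
Definition lift_labelling (R : Type) (k n : nat) (G' G : wdigraph R)
  (pv : vertex G' -> vertex G) (v : 'I_n -> vertex G)
  (lab : 'I_n -> nat -> vertex G') : Prop :=
  forall i : 'I_n,
    perm_eq [seq lab i t | t <- iota 1 k] (enum (pv @^-1: [set v i])).

Section CoverMatrix.
Variables (R : comNzRingType) (k n : nat) (G' : wdigraph R).
Variable lab : 'I_n -> nat -> vertex G'.

(* Inverse of mxvec_index: a = t * n + i is sent to (t, i). *)
Definition block_index (a : 'I_(k.-1 * n)) : 'I_k.-1 * 'I_n :=
  enum_val (cast_ord (esym (mxvec_cast k.-1 n)) a).

Definition index_vertex (a : 'I_(k.-1 * n)) : vertex G' :=
  lab (block_index a).2 (block_index a).1.+2.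

Definition index_base (a : 'I_(k.-1 * n)) : vertex G' :=
  lab (block_index a).2 1.

Definition cover_D : 'M[R]_(k.-1 * n) :=
  diag_mx (\row_a \sum_(e in edges_from (index_vertex a)) wt e).

Definition cover_A : 'M[R]_(k.-1 * n) :=
  \matrix_(a, b)
    (\sum_(e in edges_between (index_vertex a) (index_vertex b)) wt e
     - \sum_(e in edges_between (index_vertex a) (index_base b)) wt e).

Definition cover_L : 'M[R]_(k.-1 * n) := cover_D - cover_A.

End CoverMatrix.

(* Main.v *)
Require Import Defs.
From HB Require Import structures.
From mathcomp Require Import all_boot all_order all_fingroup all_algebra.
From mathcomp Require Import fraction mpoly.
From mathcomp Require Import boolp.

Set Implicit Arguments.
Unset Strict Implicit.
Unset Printing Implicit Defensive.

Import GRing.Theory.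
Local Open Scope ring_scope.

(** Write L and L~ for the Laplacians (out-degree minus adjacency, weighted) of
    the base graph and of its cover.  The statement follows, over any
    commutative ring, from the identity
      k * A_{w'}(cover) = A_w(base) * \det cover_L,
    which is the evaluation of one determinant in two ways.

    Since the rows of a Laplacian sum to zero, adding a row vector y to its row
    w gives a matrix of determinant (\sum y) * A_w; this is a form of the
    directed matrix-tree theorem ([matrix_tree], [det_laplacian_add_row]).
    Apply it to L~, with y the indicator of the fibre of w, added to the row of
    the lift w': the determinant is k * A_{w'}(cover), as a fibre has k
    elements.

    On the other hand, let S be the unipotent matrix which replaces the row of
    the first lift of each vertex by the sum of the rows of its fibre.  Because
    the projection is bijective on incoming edges, summing the rows of L~ over
    a fibre gives a row of L pulled back to the cover
    ([cover_laplacian_fiber]).  Hence S conjugates L~ to a block lower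
    triangular matrix with diagonal blocks L and cover_L.  The perturbation
    above is conjugated to one which is supported in the first block column and
    adds the unit vector of w to row w of L; so the determinant is also
    A_w(base) * \det cover_L.

    The matrix-tree theorem itself comes from expanding each row x of the
    Laplacian, other than the root row, as a sum over the edges leaving x.  The
    determinant becomes a sum over all choices p of one outgoing edge at each
    non-root vertex, and the contribution of p is its weight if following p
    leads every vertex to the root, and 0 otherwise ([det_functional_graph]).
    The choices of the first kind correspond to the arborescences
    ([arb_sum_parents]). *)

(** * Determinants of matrices with vanishing row sums *)

Section RowSums.
Variable R : comNzRingType.

(** Over a ring with zero divisors u != 0 would not be enough; an entry equal to
    1 is, as the adjugate turns A *m u = 0 into \det A * u i 0 = 0. *)
Lemma det_eq0_ker n (A : 'M[R]_n) (u : 'cV_n) i :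
  A *m u = 0 -> u i 0 = 1 -> \det A = 0.
Proof.
move=> Au ui.
have : (\adj A *m A *m u) i 0 = 0 by rewrite -mulmxA Au mulmx0 mxE.
by rewrite mul_adj_mx mul_scalar_mx mxE ui mulr1.
Qed.

Definition replace_row_delta n (r : 'I_n) (A : 'M[R]_n) : 'M[R]_n :=
  \matrix_(i, j) if i == r then (i == j)%:R else A i j.

(** The determinant is linear in row r, and it vanishes when row r sums to zero
    as well, since then the constant vector is in the kernel; so it depends on
    row r through its sum only. *)
Lemma det_row_sums0 n (r : 'I_n) (A : 'M[R]_n) :
  (forall i, i != r -> \sum_j A i j = 0) ->
  \det A = (\sum_j A r j) * \det (replace_row_delta r A).
Proof.
move=> A0; set s := \sum_j A r j.
pose B : 'M[R]_n :=
  \matrix_(i, j) (A i j - (if i == r then s * (r == j)%:R else 0)).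
have detB : \det B = 0.
  apply: (@det_eq0_ker _ B (const_mx 1) r); last by rewrite mxE.
  apply/matrixP => i j; rewrite !mxE.
  under eq_bigr do rewrite !mxE mulr1.
  rewrite sumrB; have [-> | ir] := eqVneq i r.
    rewrite -/s (bigD1 r) //= eqxx mulr1 big1 ?addr0 ?subrr // => l lr.
    by rewrite eq_sym (negbTE lr) mulr0.
  by rewrite A0 // big1 ?subrr.
rewrite (@determinant_multilinear _ _ A B (replace_row_delta r A) r 1 s).
- by rewrite detB mulr0 add0r.
- by apply/rowP => j; rewrite !mxE eqxx mul1r subrK.
- by apply/matrixP => i j; rewrite !mxE eq_sym (negbTE (neq_lift _ _)) subr0.
- by apply/matrixP => i j; rewrite !mxE eq_sym (negbTE (neq_lift _ _)).
Qed.

End RowSums.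

(** * The determinant of a functional graph *)

Section FunctionalGraphs.
Variables (V : finType) (g : V -> V) (w : V).

Lemma fconnect_step x : x != w -> fconnect g x w = fconnect g (g x) w.
Proof.
move=> xw; apply/idP/idP; last exact: connect_trans (fconnect1 g x).
move/iter_findex; case: (findex g x w) => [/eqP|m]; first by rewrite (negbTE xw).
by rewrite iterSr => <-; apply: fconnect_iter.
Qed.

(** The height is the number of steps needed to reach w. *)
Lemma exists_height :
    (forall x, fconnect g x w) ->
  exists h : V -> nat, forall x, x != w -> h x = (h (g x)).+1.
Proof.
move=> gw.
have reach x : exists m, iter m g x == w.
  by exists (findex g x w); rewrite iter_findex.
exists (fun x => ex_minn (reach x)) => x xw.
case: ex_minnP => m xm m_min; case: ex_minnP => l gl l_min.
case: m xm m_min => [xm|m]; first by rewrite xm in xw.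
rewrite iterSr => xm m_min; apply/anti_leq/andP; split.
  by apply: m_min; rewrite iterSr.
by rewrite ltnS l_min.
Qed.

(** If every vertex flows to w, only the identity contributes to the Leibniz
    formula: a permutation with a nonzero term moves a vertex along g, so its
    cycle through a moved vertex is an orbit of g that avoids w.  Otherwise the
    indicator of the vertices that do not flow to w is in the kernel. *)
Lemma det_functional_graph (R : comNzRingType) n (b : 'I_n -> V) :
    bijective b ->
  \det (\matrix_(i, j)
    ((b i == b j)%:R - ((b i != w) && (g (b i) == b j))%:R) : 'M[R]_n)
  = [forall x, fconnect g x w]%:R.
Proof.
move=> [a bK aK]; set M := \matrix_(i, j) _.
case: (boolP [forall x, fconnect g x w]) => [/forallP gw | /forallPn[x xw]].
  have not_fixed x : g x = x -> x != w -> False.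
    move=> gx xw; have /iter_findex := gw x.
    have -> l : iter l g x = x by elim: l => //= l ->.
    by move/eqP; rewrite (negbTE xw).
  rewrite /determinant (bigD1 (1%g : {perm 'I_n})) //= [X in _ + X]big1 ?addr0.
    rewrite odd_perm1 mul1r big1 // => i _; rewrite mxE perm1 eqxx.
    case: (eqVneq (b i) w) => [_|iw] /=; first by rewrite subr0.
    by case: eqP => [/not_fixed /(_ iw)|] //; rewrite subr0.
  move=> s s1.
  have [i si M0] : exists2 i, s i != i & ~~ ((b i != w) && (g (b i) == b (s i))).
    apply/exists_inP; apply: contraNT s1.
    rewrite negb_exists_in => /forall_inP all_moved.
    apply/eqP/permP => i; rewrite perm1; apply/eqP; apply: contraT => si.
    have moved m : s (iter m s i) != iter m s i.
      elim: m => //= m; apply: contra => /eqP /perm_inj smi.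
      by rewrite smi.
    have follow m : b (iter m s i) = iter m g (b i).
      elim: m => //= m <-; have := all_moved _ (moved m).
      by rewrite negbK => /andP[_ /eqP->].
    have := all_moved _ (moved (findex g (b i) w)).
    by rewrite negbK follow iter_findex // eqxx.
  rewrite (bigD1 i) //= mxE (negbTE M0) subr0 (inj_eq (can_inj bK)).
  by rewrite eq_sym (negbTE si) mul0r mulr0.
apply: (@det_eq0_ker _ _ M (\col_i (~~ fconnect g (b i) w)%:R) (a x)); last first.
  by rewrite mxE aK xw.
apply/matrixP => i j; rewrite !mxE.
under eq_bigr do rewrite !mxE mulrBl.
rewrite sumrB (bigD1 i) //= eqxx mul1r big1 ?addr0; last first.
  by move=> l li; rewrite (inj_eq (can_inj bK)) eq_sym (negbTE li) mul0r.
case: (eqVneq (b i) w) => [->|iw] /=.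
  by rewrite connect0 big1 ?subrr // => l _; rewrite mul0r.
rewrite (bigD1 (a (g (b i)))) //= aK eqxx mul1r big1 ?addr0.
  by rewrite fconnect_step // subrr.
by move=> l; rewrite -(inj_eq (can_inj bK)) aK eq_sym => /negbTE->; rewrite mul0r.
Qed.

End FunctionalGraphs.

(** * Arborescences as choices of parent edges *)

Section ParentChoices.
Variables (R : comNzRingType) (G : wdigraph R).
Implicit Types (T : {set edge G}) (x y w : vertex G).

(** The value None is the only option at the root w, so that a choice of options
    is a total function on vertices. *)
Definition parent_options w x : pred (option (edge G)) :=
  fun o => if o is Some e then (x != w) && (src e == x) else x == w.

Definition parent_step (p : {ffun vertex G -> option (edge G)}) x : vertex G :=
  if p x is Some e then tgt e else x.

Definition parent_edges (p : {ffun vertex G -> option (edge G)})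
  : {set edge G} := [set e | p (src e) == Some e].

Definition parents_in T : {ffun vertex G -> option (edge G)} :=
  [ffun x => [pick e in T | src e == x]].

Lemma parent_edgesK w p :
  p \in family (parent_options w) -> parents_in (parent_edges p) = p.
Proof.
move/familyP => pw; apply/ffunP => x; rewrite ffunE.
case: pickP => [e /andP[] | no_e]; first by rewrite inE => /eqP <- /eqP ->.
case px: (p x) => [e|] //; have := pw x; rewrite px => /andP[_ /eqP ex].
by have := no_e e; rewrite inE ex px !eqxx.
Qed.

Section Walks.
Variables (T : {set edge G}) (w : vertex G).

Lemma diwalk_path e q y :
  diwalk T (tgt e) q y =
  [&& all (mem T) q, path (fun d d' : edge G => tgt d == src d') e q
    & tgt (last e q) == y].
Proof.
elim: q e => [|d q IHq] e //=; rewrite IHq [src d == _]eq_sym.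
by case: (d \in T); case: (tgt e == src d); rewrite ?andbF.
Qed.

Lemma dipath_prefix x q y z :
    dipath T x q y -> z \in x :: [seq tgt e | e <- q] ->
  exists q', dipath T x q' z.
Proof.
move=> /andP[xq uq] zq.
suff [q' xq' q'q] : exists2 q', diwalk T x q' z & subseq q' q.
  exists q'; rewrite /dipath xq'; apply: subseq_uniq uq.
  by rewrite /= eqxx map_subseq.
move: zq; elim: q x xq {uq} => [|e q IHq] x /=.
  by move=> _; rewrite inE => /eqP->; exists [::] => /=.
move=> /and3P[eT ex eq]; rewrite inE => /predU1P[->|zq].
  by exists [::] => //=.
have [q' eq' q'q] := IHq _ eq zq.
by exists (e :: q'); rewrite /= ?eT ?ex ?eqxx.
Qed.

(** The vertices of the cycle are those of the path, rotated by one place; the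
    edges are distinct because their sources are. *)
Lemma closed_dipath_ucycle e q :
    e \in T -> dipath T (tgt e) q (src e) ->
  ucycle_in T [seq (d, true) | d <- e :: q].
Proof.
move=> eT /andP[]; rewrite diwalk_path => /and3P[qT eq /eqP last_q] uq.
have uniq_src : uniq [seq src d | d <- e :: q].
  have src_q : [seq src d | d <- q] = belast (tgt e) [seq tgt d | d <- q].
    elim: q e eq {qT last_q uq eT} => //= d q IHq e /andP[/eqP <- dq].
    by rewrite (IHq d).
  move: uq; rewrite lastI last_map last_q rcons_uniq -src_q.
  by rewrite -cons_uniq.
apply/and5P; split=> //.
- by rewrite all_map /=; apply/andP.
- rewrite cycle_map /= rcons_path.
  by rewrite /= /dart_end /dart_start /= last_q eqxx andbT.
- by rewrite -map_comp.
by rewrite -map_comp map_id; apply: map_uniq uniq_src.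
Qed.

Lemma sym_uadj : ssrbool.symmetric (uadj T).
Proof.
move=> x y; apply/exists_inP/exists_inP => [] [e eT]; rewrite orbC => xy;
by exists e.
Qed.

End Walks.

Section ArborescenceParents.
Variables (T : {set edge G}) (w : vertex G).
Hypothesis arbT : arborescence T w.

Lemma arborescence_no_dicycle e q :
  e \in T -> dipath T (tgt e) q (src e) -> False.
Proof.
case: arbT => [[_ acyclic] _] eT eq.
by have := acyclic [seq (d, true) | d <- e :: q]; rewrite closed_dipath_ucycle.
Qed.

Lemma arborescence_src_neq e : e \in T -> src e != w.
Proof.
move=> eT; apply/eqP => ew; case: arbT => _ /(_ (tgt e))[q [eq _]].
by rewrite -ew in eq; apply: arborescence_no_dicycle eq.
Qed.

(** If e leaves x, then x is not on the path from the target of e to the root,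
    as this would close a directed cycle; so e can be prepended to that path.
    The path from x to the root being unique, e is its first edge. *)
Lemma arborescence_src_inj : {in T &, injective (@src R G)}.
Proof.
have extend e : e \in T -> exists q, dipath T (src e) (e :: q) w.
  move=> eT; case: arbT => _ /(_ (tgt e))[q [eq _]]; exists q.
  move: (eq) => /andP[walk_q uq]; rewrite /dipath /= eT eqxx walk_q /= andbC.
  move: uq => /= -> /=; apply/negP => e_q.
  have [q' /(arborescence_no_dicycle eT)] := dipath_prefix eq e_q.
  by [].
move=> e e' /extend[q eq] /extend[q' eq'] ee'.
case: arbT => _ /(_ (src e))[r [_ r_uniq]].
by rewrite -ee' in eq'; have := r_uniq _ eq; rewrite (r_uniq _ eq') => -[].
Qed.

Lemma arborescence_parents e : e \in T -> parents_in T (src e) = Some e.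
Proof.
move=> eT; rewrite ffunE; case: pickP => [d /andP[dT /eqP de]|/(_ e)].
  by rewrite (arborescence_src_inj dT eT).
by rewrite eT eqxx.
Qed.

Lemma arborescence_parents_family :
  parents_in T \in family (parent_options w).
Proof.
apply/familyP => x; rewrite ffunE unfold_in.
case: pickP => [e /andP[eT /eqP<-] | no_e] /=.
  by rewrite eqxx arborescence_src_neq.
case: arbT => _ /(_ x)[[|e q] [/andP[/= walk_q _] _]] //.
by have := no_e e; case/and3P: walk_q => -> ->.
Qed.

Lemma arborescence_parentsK : parent_edges (parents_in T) = T.
Proof.
apply/setP => e; rewrite inE; apply/eqP/idP => [|eT].
  by rewrite ffunE; case: pickP => // d /andP[dT _] [<-].
exact: arborescence_parents.
Qed.

Lemma arborescence_reach x : fconnect (parent_step (parents_in T)) x w.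
Proof.
case: arbT => _ /(_ x)[q [/andP[walk_q _] _]].
elim: q x walk_q => [|e q IHq] x /=; first by move/eqP->.
move=> /and3P[eT /eqP ex /IHq]; apply: connect_trans.
apply: connect1; apply/eqP.
by rewrite /= /parent_step -ex arborescence_parents.
Qed.

End ArborescenceParents.

Section ParentsArborescence.
Variables (w : vertex G) (p : {ffun vertex G -> option (edge G)}).
Hypothesis pw : p \in family (parent_options w).
Hypothesis reach : forall x, fconnect (parent_step p) x w.

Lemma parent_root : p w = None.
Proof.
by have := familyP pw w; case: (p w) => // e; rewrite unfold_in /= eqxx.
Qed.

Lemma parent_edge x : x != w ->
  exists e, [/\ p x = Some e, e \in parent_edges p & src e = x].
Proof.
move=> xw; have := familyP pw x; case px: (p x) => [e|]; rewrite unfold_in /=.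
  by move=> /andP[_ /eqP ex]; exists e; rewrite inE ex px eqxx.
by rewrite (negbTE xw).
Qed.

Lemma parent_edges_src_neq e : e \in parent_edges p -> src e != w.
Proof. by rewrite inE; apply: contraTneq => ->; rewrite parent_root. Qed.

Lemma parent_edges_height : exists h : vertex G -> nat,
  forall e, e \in parent_edges p -> h (src e) = (h (tgt e)).+1.
Proof.
have [h hP] := exists_height reach; exists h => e eT.
rewrite hP ?parent_edges_src_neq //.
by move: eT; rewrite inE /parent_step => /eqP->.
Qed.

Lemma parent_edges_connected x y : connect (uadj (parent_edges p)) x y.
Proof.
have to_w z : connect (uadj (parent_edges p)) z w.
  apply: (connect_sub _ (reach z)) => {}z t /eqP <-; rewrite /parent_step.
  have [->|zw] := eqVneq z w; first by rewrite parent_root connect0.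
  have [e [-> eT ez]] := parent_edge zw.
  apply: connect1; apply/exists_inP; exists e => //.
  by rewrite !inE ez !eqxx.
apply: connect_trans (to_w x) _.
by rewrite sym_connect_sym ?to_w //; apply: sym_uadj.
Qed.

(** At a vertex of maximal height of the cycle, the edges by which the cycle
    enters and leaves must both be the parent edge of this vertex, as every
    edge goes down one level; but a cycle repeats no edge. *)
Lemma parent_edges_acyclic c : ~~ ucycle_in (parent_edges p) c.
Proof.
have [h hP] := parent_edges_height.
apply/negP => /and5P[c0 /allP cT cyc_c _ uniq_c].
have [d0 d0c] : exists d0, d0 \in c.
  by case: c c0 {cT cyc_c uniq_c} => // d0 c _; exists d0; rewrite inE eqxx.
case: (arg_maxnP (fun d : edge G * bool => h (dart_start d)) d0c) => d dc d_max.
have end_max t : t \in c -> (h (dart_end t) <= h (dart_start d))%N.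
  move=> tc; rewrite (eqP (next_cycle cyc_c tc)).
  have next_c : next c t \in c by rewrite mem_next.
  exact: d_max next_c.
have d2 : d.2.
  apply: contraT => d2; have := end_max d dc.
  by rewrite /dart_end /dart_start (negbTE d2) hP ?ltnn //; apply: cT.
pose t := prev c d; have tc : t \in c by rewrite mem_prev.
have td : dart_end t = dart_start d by apply/eqP; exact: (prev_cycle cyc_c dc).
have t2 : ~~ t.2.
  apply/negP => t2; have := d_max t tc; rewrite /= -td /dart_end /dart_start t2.
  by rewrite hP ?ltnn //; apply: cT.
have t1 : t.1 = d.1.
  have := cT t tc; have := cT d dc; rewrite !inE /=.
  move: td; rewrite /dart_end /dart_start (negbTE t2) d2 => ->.
  by move=> /eqP-> /eqP[].
suff td' : t = d by rewrite td' d2 in t2.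
rewrite -(nth_index d tc) -[RHS](nth_index d dc).
congr nth; apply: (uniqP d.1 uniq_c); rewrite ?inE ?size_map ?index_mem //.
by rewrite !(nth_map d) ?index_mem // !nth_index // t1.
Qed.

Lemma parent_edges_dipath x : exists q, dipath (parent_edges p) x q w.
Proof.
have [h hP] := parent_edges_height.
suff [q xq hq] : exists2 q, dipath (parent_edges p) x q w &
    all (fun e => h (tgt e) < h x)%N q by exists q.
(* The bound on heights makes the vertices of the path distinct. *)
have [m] := ubnP (h x); elim: m x => // m IHm x hx.
have [->|xw] := eqVneq x w; first by exists [::]; rewrite /dipath /= ?eqxx.
have [e [_ eT ex]] := parent_edge xw.
have e_lt : (h (tgt e) < h x)%N by rewrite -ex hP.
have [|q /andP[eq uq] hq] := IHm (tgt e); first exact: leq_trans e_lt _.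
have hq' : all (fun d => h (tgt d) < h x)%N q.
  by apply: sub_all hq => d /ltn_trans; apply.
exists (e :: q); last by rewrite /= e_lt.
rewrite /dipath /= eT ex eqxx eq /= andbC; move: uq => /= -> /=.
apply/negP; rewrite -map_cons => /mapP[d dq xd].
have : all (fun d => h (tgt d) < h x)%N (e :: q) by rewrite /= e_lt.
by move/allP/(_ d dq); rewrite -xd ltnn.
Qed.

Lemma parent_edges_diwalk_uniq x q q' :
    diwalk (parent_edges p) x q w -> diwalk (parent_edges p) x q' w ->
  q = q'.
Proof.
elim: q x q' => [|e q IHq] x [|e' q'] //=.
- move=> /eqP-> /and3P[/parent_edges_src_neq/negP e'w e'x _].
  by case: e'w; rewrite e'x.
- move=> /and3P[/parent_edges_src_neq/negP ew ex _] /eqP xw.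
  by case: ew; rewrite -xw.
move=> /and3P[eT /eqP ex eq] /and3P[e'T /eqP e'x e'q].
have [ee'] : Some e = Some e'.
  by move: eT e'T; rewrite !inE ex e'x => /eqP <- /eqP <-.
by rewrite -ee' in e'q *; rewrite (IHq _ _ eq e'q).
Qed.

Lemma parent_edges_arborescence : arborescence (parent_edges p) w.
Proof.
split; first by split; [apply: parent_edges_connected | apply: parent_edges_acyclic].
move=> x; have [q xq] := parent_edges_dipath x; exists q; split=> // q' xq'.
by case/andP: xq xq' => xq _ /andP[xq' _]; apply: parent_edges_diwalk_uniq xq'.
Qed.

End ParentsArborescence.

Lemma parent_edges_weight w p :
    p \in family (parent_options w) ->
  \prod_(e in parent_edges p) wt e
  = \prod_x (if p x is Some e then wt e else 1).
Proof.
move=> pw; rewrite [RHS](bigID (fun x => p x == None)) /=.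
rewrite [X in _ = X * _]big1 ?mul1r; last first.
  by move=> x /eqP->.
rewrite [RHS](reindex_omap (@src R G) p) /=.
  apply: eq_big => [e|e]; rewrite inE.
    by case: eqP => [->|]; rewrite ?andbF.
  by move/eqP->.
move=> x px; case: (eqVneq x w) px => [->|xw _]; first by rewrite (parent_root pw).
by have [e [-> _ ex]] := parent_edge pw xw; rewrite /= ex.
Qed.

(** T |-> parents_in T is a bijection from the arborescences rooted at w to the
    choices of parents that lead every vertex to w, with inverse
    parent_edges. *)
Lemma arb_sum_parents w :
  arb_sum w = \sum_(p in family (parent_options w))
    (\prod_x (if p x is Some e then wt e else 1))
    * [forall x, fconnect (parent_step p) x w]%:R.
Proof.
rewrite /arb_sum (reindex_onto parent_edges parents_in); last first.
  by move=> T /asboolP; apply: arborescence_parentsK.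
rewrite [RHS](bigID (fun p => [forall x, fconnect (parent_step p) x w])) /=.
rewrite [X in _ = _ + X]big1 ?addr0; last first.
  by move=> p /andP[_ /negbTE->]; rewrite mulr0.
apply: eq_big => [p | p /andP[/asboolP arb_p /eqP pK]].
  apply/andP/andP => [[/asboolP arb_p /eqP pK] | [pw /forallP reach]].
    have pw : p \in family (parent_options w).
      by rewrite -pK; apply: arborescence_parents_family.
    split=> //; apply/forallP => x.
    by have := arborescence_reach arb_p x; rewrite pK.
  split; last by rewrite (parent_edgesK pw).
  by apply/asboolP; apply: parent_edges_arborescence.
have pw : p \in family (parent_options w).
  by rewrite -pK; apply: arborescence_parents_family.
have -> : [forall x, fconnect (parent_step p) x w].
  by apply/forallP => x; have := arborescence_reach arb_p x; rewrite pK.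
by rewrite mulr1 (parent_edges_weight pw).
Qed.

End ParentChoices.

(** * The directed matrix-tree theorem *)

Section MatrixTree.
Variables (R : comNzRingType) (G : wdigraph R).
Implicit Types (x y w : vertex G).

Definition laplacian_entry x y : R :=
  (x == y)%:R * (\sum_(e in edges_from x) wt e)
  - \sum_(e in edges_between x y) wt e.

(** Rows and columns are indexed separately so that the blocks of a Laplacian are
    again of this form. *)
Definition laplacian q r (b : 'I_q -> vertex G) (c : 'I_r -> vertex G)
  : 'M[R]_(q, r) := \matrix_(i, j) laplacian_entry (b i) (c j).

Lemma laplacian_entry_edges x y :
  laplacian_entry x y
  = \sum_(e in edges_from x) wt e * ((x == y)%:R - (tgt e == y)%:R).
Proof.
rewrite /laplacian_entry; under [RHS]eq_bigr do rewrite mulrBr mulrC.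
rewrite sumrB mulr_sumr; congr (_ - _).
rewrite [RHS](bigID (fun e => tgt e == y)) /= [X in _ = _ + X]big1 ?addr0; last first.
  by move=> e /andP[_ /negbTE->]; rewrite mulr0.
apply: eq_big => [e|e]; first by rewrite !inE.
by rewrite !inE => /andP[_ ->]; rewrite mulr1.
Qed.

Lemma laplacian_entry_sum0 n (b : 'I_n -> vertex G) x :
  bijective b -> \sum_j laplacian_entry x (b j) = 0.
Proof.
move=> [a bK aK].
under eq_bigr do rewrite laplacian_entry_edges.
rewrite exchange_big big1 //= => e _; rewrite -mulr_sumr sumrB.
have delta_sum z : \sum_j (z == b j)%:R = 1 :> R.
  rewrite (bigD1 (a z)) //= aK eqxx big1 ?addr0 // => j ja.
  by rewrite -[z]aK (inj_eq (can_inj bK)) eq_sym (negbTE ja).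
by rewrite !delta_sum subrr mulr0.
Qed.

(** Each row of the Laplacian, with the root row replaced by a unit vector, as a
    sum over the options for the parent of x: this is what makes the Leibniz
    formula distribute over choices of parents. *)
Lemma rooted_laplacian_options w x y :
  (if x == w then (x == y)%:R else laplacian_entry x y)
  = \sum_(o | parent_options w x o)
      (if o is Some e then wt e else 1)
      * ((x == y)%:R - (if o is Some e then (tgt e == y)%:R else 0)).
Proof.
have [xw | xw] := eqVneq x w.
  rewrite (big_pred1 None) ?mul1r ?subr0 // => -[e|] /=.
    by rewrite xw eqxx.
  by rewrite xw eqxx.
rewrite laplacian_entry_edges (reindex_omap Some id); last first.
  by case=> //=; rewrite (negbTE xw).
by apply: eq_bigl => e; rewrite /= inE xw eqxx andbT.
Qed.

(** Distributing the products of the Leibniz formula over the options gives, for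
    each choice p of parents, the weight of p times the determinant of the
    functional graph of p. *)
Theorem matrix_tree n (b : 'I_n -> vertex G) (r : 'I_n) :
    bijective b ->
  arb_sum (b r) = \det (replace_row_delta r (laplacian b b)).
Proof.
move=> bij_b; case: (bij_b) => a bK aK; set w := b r.
pose c (o : option (edge G)) : R := if o is Some e then wt e else 1.
pose N x o y : R := (x == y)%:R - (if o is Some e then (tgt e == y)%:R else 0).
rewrite arb_sum_parents.
transitivity (\sum_(p in family (parent_options w))
   (\prod_x c (p x)) * \det (\matrix_(i, j) N (b i) (p (b i)) (b j) : 'M[R]_n)).
  apply: eq_bigr => p pw; congr (_ * _).
  rewrite -(det_functional_graph _ _ _ bij_b); congr (\det _).
  apply/matrixP => i j; rewrite !mxE /N /parent_step.
  have := familyP pw (b i); case: (p (b i)) => [e|]; rewrite unfold_in /=.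
    by case/andP=> ->.
  by move=> ->.
under eq_bigr do rewrite mulr_sumr.
rewrite exchange_big /=; apply: eq_bigr => s _.
under eq_bigr do rewrite mulrCA.
rewrite -mulr_sumr; congr (_ * _).
have entryE i : replace_row_delta r (laplacian b b) i (s i)
    = \sum_(o | parent_options w (b i) o) c o * N (b i) o (b (s i)).
  rewrite -rooted_laplacian_options !mxE /w !(inj_eq (can_inj bK)).
  by case: eqP.
under [RHS]eq_bigr do rewrite entryE.
rewrite [RHS](reindex a) /=; last by exists b => i _; rewrite ?aK ?bK.
under [RHS]eq_bigr do rewrite aK.
rewrite bigA_distr_big_dep /=; apply: eq_bigr => p pw.
rewrite big_split /=; congr (_ * _).
rewrite [LHS](reindex a) /=; last by exists b => i _; rewrite ?aK ?bK.
by apply: eq_bigr => x _; rewrite mxE aK.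
Qed.

Lemma det_laplacian_add_row n (b : 'I_n -> vertex G) (r : 'I_n) (y : 'rV_n) :
    bijective b ->
  \det (laplacian b b + delta_mx r 0 *m y) = (\sum_j y 0 j) * arb_sum (b r).
Proof.
move=> bij_b.
have entry i j : (delta_mx r 0 *m y : 'M[R]_n) i j = (i == r)%:R * y 0 j.
  by rewrite mxE big_ord1 !mxE eqxx andbT.
rewrite (det_row_sums0 (r := r)) => [|i ir]; last first.
  under eq_bigr do rewrite mxE entry (negbTE ir) mul0r addr0 mxE.
  exact: laplacian_entry_sum0.
rewrite (matrix_tree r bij_b); congr (_ * _); last congr (\det _).
  under eq_bigr do rewrite mxE entry eqxx mul1r mxE.
  by rewrite big_split /= laplacian_entry_sum0 // add0r.
apply/matrixP => i j; rewrite mxE [in RHS]mxE; case: eqVneq => // ir.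
by rewrite mxE entry (negbTE ir) mul0r addr0.
Qed.

End MatrixTree.

(** * The Laplacian of a cover *)

Section CoverLaplacian.
Variables (R : comNzRingType) (k n : nat) (G G' : wdigraph R).
Variables (pv : vertex G' -> vertex G) (pe : edge G' -> edge G).
Hypothesis hcover : is_cover k pv pe.

Lemma cover_sum_from x :
  \sum_(e in edges_from x) wt e = \sum_(e in edges_from (pv x)) wt e.
Proof.
have [pe_inj <-] := cover_from hcover x.
by rewrite big_imset //; apply: eq_bigr => e _; apply: cover_wt hcover _.
Qed.

Lemma cover_sum_to u y :
  \sum_(x | pv x == u) \sum_(e in edges_between x y) wt e
  = \sum_(e in edges_between u (pv y)) wt e.
Proof.
have [pe_inj im_pe] := cover_to hcover y.
transitivity (\sum_(e in edges_to y | src (pe e) == u) wt (pe e)).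
  rewrite (partition_big (@src R G') (fun x => pv x == u)) /=; last first.
    by move=> e /andP[_]; rewrite (cover_src hcover).
  apply: eq_bigr => x xu; apply: eq_big => [e|e _].
    rewrite !inE (cover_src hcover) andbC.
    by case: (eqVneq (src e) x) => [->|]; rewrite ?xu ?andbT ?andbF.
  exact: cover_wt hcover _.
rewrite -(big_imset_cond _ (fun f => src f == u) _ pe_inj) im_pe.
by apply: eq_bigl => e; rewrite !inE andbC.
Qed.

(** Summing the rows of the cover over a fibre gives a row of the base, pulled
    back.  The diagonal part uses that pe is bijective on the edges leaving y,
    the adjacency part that it is bijective on the edges entering y. *)
Lemma cover_laplacian_fiber u y :
  \sum_(x | pv x == u) laplacian_entry x y = laplacian_entry u (pv y).
Proof.
rewrite /laplacian_entry sumrB cover_sum_to; congr (_ - _).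
have [yu | yu] := eqVneq u (pv y).
  rewrite (bigD1 y) ?yu //= eqxx mul1r cover_sum_from.
  rewrite [X in _ + X]big1 ?addr0 ?mul1r ?yu // => x /andP[_ /negbTE->].
  by rewrite mul0r.
rewrite mul0r big1 // => x /eqP xu.
by case: eqVneq => [xy|]; rewrite ?mul0r // -xu xy eqxx in yu *.
Qed.

Variables (v : 'I_n -> vertex G) (lab : 'I_n -> nat -> vertex G').
Hypothesis bij_v : bijective v.
Hypothesis hlab : lift_labelling k pv v lab.
Hypothesis k_gt0 : (0 < k)%N.

Local Notation N := (k.-1 * n)%N.
Local Notation base_lift := (fun i => lab i 1).
Local Notation other_lift := (@index_vertex R k n G' lab).

(** The row i of this matrix is the indicator of the lifts of v i other than the
    first, in the order of the rows of cover_L. *)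
Definition block_delta : 'M[R]_(n, N) :=
  \matrix_(i, a) (i == (block_index a).2)%:R.

(** An enumeration of the vertices of the cover in which the first lifts come
    first, and the other lifts follow in the order of cover_L. *)
Definition all_lifts (i : 'I_(n + N)) : vertex G' :=
  match split i with inl j => base_lift j | inr a => other_lift a end.

Lemma all_lifts_l i : all_lifts (lshift N i) = base_lift i.
Proof. by rewrite /all_lifts (unsplitK (inl i)). Qed.

Lemma all_lifts_r a : all_lifts (rshift n a) = other_lift a.
Proof. by rewrite /all_lifts (unsplitK (inr a)). Qed.

Lemma block_index_bij : bijective (@block_index k n).
Proof.
apply: bij_comp; first exact: enum_val_bij.
exists (cast_ord (mxvec_cast k.-1 n)); [exact: cast_ordKV | exact: cast_ordK].
Qed.

Lemma block_index_lt (a : 'I_N) : ((block_index a).1.+2 \in iota 1 k).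
Proof.
by rewrite mem_iota add1n /= ltnS -ltn_predRL.
Qed.

Lemma lab_lift i t : t \in iota 1 k -> pv (lab i t) = v i.
Proof.
move=> tk; have : lab i t \in enum (pv @^-1: [set v i]).
  by rewrite -(perm_mem (hlab i)) map_f.
by rewrite mem_enum !inE => /eqP.
Qed.

Lemma one_in_iota : 1%N \in iota 1 k.
Proof. by rewrite mem_iota /= add1n ltnS. Qed.

Lemma lab_inj i j s t :
  s \in iota 1 k -> t \in iota 1 k -> lab i s = lab j t -> i = j /\ s = t.
Proof.
move=> sk tk eq_lab.
have ij : i = j by apply: (bij_inj bij_v); rewrite -(lab_lift i sk) eq_lab lab_lift.
split=> //; rewrite -{}ij in eq_lab.
have uniq_lab : uniq [seq lab i t | t <- iota 1 k].
  by rewrite (perm_uniq (hlab i)) enum_uniq.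
rewrite -(nth_index 0%N sk) -(nth_index 0%N tk); congr nth.
apply: (uniqP (lab i 0) uniq_lab); rewrite ?inE ?size_map ?index_mem //.
by rewrite !(nth_map 0%N) ?index_mem // !nth_index.
Qed.

Lemma all_lifts_bij : bijective all_lifts.
Proof.
apply: inj_card_bij.
  move=> i j; rewrite -(splitK i) -(splitK j).
  case: (split i) => a; case: (split j) => b /=;
    rewrite ?all_lifts_l ?all_lifts_r.
  - by case/lab_inj; rewrite ?one_in_iota // => ->.
  - by case/lab_inj; rewrite ?one_in_iota ?block_index_lt.
  - by case/lab_inj; rewrite ?one_in_iota ?block_index_lt.
  case/lab_inj; rewrite ?block_index_lt // => eq2 [eq1].
  congr rshift; apply: (bij_inj block_index_bij).
  case: (block_index a) (block_index b) eq1 eq2 => [s i'] [t j'] /= st ->.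
  by congr pair; apply: val_inj.
apply: leq_trans (leq_image_card all_lifts predT); apply: subset_leq_card.
apply/subsetP => y _; apply/imageP.
have [u uK vK] := bij_v.
have : y \in enum (pv @^-1: [set v (u (pv y))]) by rewrite mem_enum !inE vK.
rewrite -(perm_mem (hlab _)) => /mapP[t]; rewrite mem_iota.
case: t => [|[|t]] // tk ->.
  by exists (lshift N (u (pv y))); rewrite ?all_lifts_l.
have tk' : (t < k.-1)%N by rewrite ltn_predRL -ltnS -add1n.
have [c _ cK] := block_index_bij.
exists (rshift n (c (Ordinal tk', u (pv y)))); rewrite ?all_lifts_r //.
by rewrite /index_vertex cK.
Qed.

Lemma sum_fiber (f : vertex G' -> R) i :
  f (base_lift i) + \sum_a block_delta i a * f (other_lift a)
  = \sum_(x | pv x == v i) f x.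
Proof.
have -> : \sum_(x | pv x == v i) f x = \sum_(t <- iota 1 k) f (lab i t).
  rewrite -(big_map (lab i) xpredT f) (perm_big _ (hlab i)) big_enum.
  by apply: eq_bigl => x; rewrite !inE.
have -> : iota 1 k = 1%N :: iota 2 k.-1 by rewrite -[in LHS](prednK k_gt0).
rewrite big_cons; congr (_ + _).
under [LHS]eq_bigr do rewrite mxE.
transitivity (\sum_(c : 'I_k.-1 * 'I_n) (i == c.2)%:R * f (lab c.2 c.1.+2)).
  by rewrite (reindex (@block_index k n)) //; apply: onW_bij block_index_bij.
rewrite -(pair_bigA _ (fun (s : 'I_k.-1) j => (i == j)%:R * f (lab j s.+2))) /=.
rewrite (iotaDl 2 0) big_map -[k.-1 in RHS]subn0 big_mkord.
apply: eq_bigr => s _; rewrite (bigD1 i) //= eqxx mul1r big1 ?addr0 //.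
by move=> j; rewrite eq_sym => /negbTE->; rewrite mul0r.
Qed.

Lemma laplacian_comp (H : wdigraph R) q (b : 'I_q -> vertex H)
    (c : 'I_n -> vertex H) :
  laplacian b (fun a : 'I_N => c (block_index a).2)
  = laplacian b c *m block_delta.
Proof.
apply/matrixP => i a; rewrite !mxE (bigD1 (block_index a).2) //=.
rewrite !mxE eqxx mulr1 big1 ?addr0 // => j.
by rewrite !mxE => /negbTE->; rewrite mulr0.
Qed.

(** The left-hand side is the top half of S *m L~, where S is
    block_mx 1%:M block_delta 0 1%:M. *)
Lemma laplacian_fiber q (c : 'I_q -> vertex G') :
  laplacian base_lift c + block_delta *m laplacian other_lift c
  = laplacian v (fun i => pv (c i)).
Proof.
apply/matrixP => i j; rewrite !mxE -cover_laplacian_fiber.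
rewrite -(sum_fiber (fun x => laplacian_entry x (c j))); congr (_ + _).
by apply: eq_bigr => a _; rewrite !mxE.
Qed.

Lemma laplacian_block :
  laplacian all_lifts all_lifts
  = block_mx (laplacian base_lift base_lift) (laplacian base_lift other_lift)
             (laplacian other_lift base_lift) (laplacian other_lift other_lift).
Proof.
apply/matrixP => i j; rewrite -(splitK i) -(splitK j).
by case: (split i) => a; case: (split j) => b;
  rewrite /= ?(block_mxEul, block_mxEur, block_mxEdl, block_mxEdr) !mxE
          ?all_lifts_l ?all_lifts_r.
Qed.

(** The lower right block of the conjugate of L~ by S.  The out-degrees appear
    only on the diagonal of cover_L because a lift in a later block is never a
    first lift. *)
Lemma cover_L_laplacian :
  cover_L k lab = laplacian other_lift other_lift
                  - laplacian other_lift base_lift *m block_delta.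
Proof.
rewrite -laplacian_comp; apply/matrixP => a b; rewrite !mxE.
have all_inj := bij_inj all_lifts_bij.
rewrite /laplacian_entry /index_base -!all_lifts_r -!all_lifts_l.
rewrite !(inj_eq all_inj) !eq_shift mul0r sub0r opprB opprK addrA.
by rewrite mulr_natl addrAC.
Qed.

(** The determinant of L~ + e *m y, where e is the unit vector of w' and y the
    indicator of its fibre, is computed directly and after conjugation by S.
    The indicator y is chosen because it is a row of
    row_mx 1%:M block_delta, the top half of S: this puts e *m y into the first
    block column. *)
Theorem cover_arb_sum (w' : vertex G') :
  k%:R * arb_sum w' = arb_sum (pv w') * \det (cover_L k lab).
Proof.
have [c cK aK] := all_lifts_bij; have [u uK vK] := bij_v.
pose r := c w'; pose i := u (pv w').
rewrite -{1}(aK w') -/r -[in RHS](vK (pv w')) -/i.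
pose d : 'rV[R]_n := delta_mx 0 i.
pose y : 'rV[R]_(n + N) := row_mx d (d *m block_delta).
pose e : 'cV[R]_(n + N) := delta_mx r 0.
have base_l j : pv (base_lift j) = v j by rewrite lab_lift ?one_in_iota.
have other_l a : pv (other_lift a) = v (block_index a).2.
  by rewrite lab_lift ?block_index_lt.
have pv_v : (fun j => pv (base_lift j)) = v by apply: funext => j.
have pv_other : (fun a => pv (other_lift a)) = fun a => v (block_index a).2.
  exact: funext.
have sum_y : \sum_j y 0 j = k%:R.
  have -> : k%:R = \sum_(x | pv x == v i) 1 :> R.
    rewrite -(cover_card_vertex hcover (v i)) -sum1_card natr_sum.
    by apply: eq_bigl => x; rewrite !inE.
  rewrite big_split_ord /= -(sum_fiber (fun=> 1)).
  under eq_bigr do rewrite row_mxEl.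
  under [X in _ + X]eq_bigr do rewrite row_mxEr -rowE mxE.
  congr (_ + _); last first.
    by apply: eq_bigr => a _; rewrite mulr1.
  rewrite (bigD1 i) //= mxE !eqxx big1 ?addr0 // => j ji.
  by rewrite mxE (negbTE ji) andbF.
have e_fiber : usubmx e + block_delta *m dsubmx e = delta_mx i 0.
  apply/matrixP => j j0; rewrite ord1 !mxE ?eqxx !andbT.
  transitivity (\sum_(x | pv x == v j) (x == w')%:R : R).
    rewrite -(sum_fiber (fun x => (x == w')%:R)) -{1}(aK w') -all_lifts_l.
    rewrite (inj_eq (bij_inj all_lifts_bij)) ?eqxx ?andbT; congr (_ + _).
    apply: eq_bigr => a _; rewrite !mxE ?eqxx ?andbT -(aK w') -all_lifts_r.
    by rewrite (inj_eq (bij_inj all_lifts_bij)).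
  have -> : (j == i) = (pv w' == v j).
    by rewrite -[pv w']vK -/i (inj_eq (bij_inj bij_v)) eq_sym.
  case: eqVneq => [w'j|w'j].
    rewrite (bigD1 w') ?w'j //= eqxx big1 ?addr0 // => x /andP[_].
    by move=> /negbTE->.
  rewrite big1 // => x /eqP xj; rewrite (_ : x == w' = false) //.
  by apply: contraNF w'j => /eqP<-; rewrite xj.
have detS : \det (block_mx 1%:M block_delta 0 1%:M) = 1 :> R.
  by rewrite det_ublock !det1 mulr1.
rewrite -sum_y -(det_laplacian_add_row _ _ all_lifts_bij).
(* The determinant on the base depends on the row vector d only through its
   sum, which is 1. *)
have -> : arb_sum (v i) = \det (laplacian v v + delta_mx i 0 *m d).
  rewrite (det_laplacian_add_row _ _ bij_v) (bigD1 i) //= mxE !eqxx.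
  rewrite big1 ?addr0 ?mul1r // => j ji.
  by rewrite mxE (negbTE ji) andbF.
(* It remains to compare S *m (L~ + e *m y) with (triangular matrix) *m S. *)
rewrite -[LHS]mul1r -[X in X * _]detS -det_mulmx.
rewrite -(det_lblock _ (laplacian other_lift base_lift + dsubmx e *m d)).
rewrite -[RHS]mulr1 -[X in _ * X]detS -det_mulmx; congr (\det _).
rewrite -/e -[e]vsubmxK laplacian_block mul_col_row add_block_mx !mulmx_block.
rewrite !mul1mx !mul0mx !mulmx0 !mulmx1 !add0r !addr0 vsubmxK.
have fiber_l : laplacian base_lift base_lift
    + block_delta *m laplacian other_lift base_lift = laplacian v v.
  by rewrite laplacian_fiber pv_v.
have fiber_r : laplacian base_lift other_lift
    + block_delta *m laplacian other_lift other_lift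
    = laplacian v v *m block_delta.
  by rewrite laplacian_fiber pv_other laplacian_comp.
congr block_mx.
- rewrite mulmxDr addrACA fiber_l; congr (_ + _).
  by rewrite mulmxA -mulmxDl e_fiber.
- rewrite mulmxDr addrACA fiber_r mulmxDl; congr (_ + _).
  by rewrite !mulmxA -mulmxDl -mulmxDl e_fiber.
rewrite cover_L_laplacian mulmxDl -[in RHS]mulmxA.
by rewrite [RHS]addrAC [X in _ = X + _]addrC subrK.
Qed.

End CoverLaplacian.

(** * The theorem *)

Theorem theorem1p3 (m k n : nat)
  (G : wdigraph {mpoly int[m]}) (hG : indeterminate_weights G)
  (G' : wdigraph {mpoly int[m]})
  (pv : vertex G' -> vertex G) (pe : edge G' -> edge G)
  (hcover : is_cover k pv pe)
  (v : 'I_n -> vertex G) (hv : bijective v)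
  (lab : 'I_n -> nat -> vertex G') (hlab : lift_labelling k pv v lab)
  (w : vertex G) (hw : arb_sum w != 0)
  (w' : vertex G') (hw' : pv w' = w) :
  tofrac (arb_sum w') / tofrac (arb_sum w)
  = (k%:R)^-1 * tofrac (\det (cover_L k lab))
  :> {fraction {mpoly int[m]}}.
Proof.
have k_gt0 : (0 < k)%N.
  rewrite -(cover_card_vertex hcover w); apply/card_gt0P; exists w'.
  by rewrite !inE hw'.
have k_neq0 : k%:R != 0 :> {fraction {mpoly int[m]}}.
  rewrite -tofrac1 -tofracMn tofrac_eq0 -mpolyC_nat mpolyC_eq0.
  by rewrite Num.Theory.pnatr_eq0 -lt0n.
have := congr1 (@tofrac _) (cover_arb_sum hcover hv hlab k_gt0 w').
rewrite hw' !tofracM tofracMn tofrac1 => eq_cover.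
apply: (canLR (mulfK _)); first by rewrite tofrac_eq0.
apply: (mulfI k_neq0); rewrite eq_cover.
by rewrite mulrA mulVKf // mulrC.
Qed.
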